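(* Let the coefficient field $\alpha$ possibly be discontinuous across the coarse grid boundaries. If there exists $\rho>0$ such that $W_e\lesssim\rho$ for all $K\in\mathcal{T}_H$ and all fine edges $e\subset\partial K$, then $$\beta(\alpha)\lesssim\rho\,\frac{H}{h}.$$
   Context: $\Omega\subset\mathbb{R}^2$ is a polygonal domain, $\mathcal{T}_h$ a quasi-uniform fine triangulation with mesh size $h$, $\mathcal{T}_H$ a quasi-uniform coarse triangulation with mesh size $H$, whose element edges are aligned with edges of $\mathcal{T}_h$. The coefficient $\alpha\in L^\infty(\Omega)$ is piecewise constant on $\mathcal{T}_h$, with $\alpha(x)\ge\alpha_0>0$. $A\lesssim B$ means $A\le CB$ with $C>0$ depending only on the shape regularity of the meshes. $h_e$ is the length of the fine edge $e$. For an interior fine edge $e$ shared by fine elements with coefficients $\alpha_+^e,\alpha_-^e$, $W_e=2\alpha_+^e\alpha_-^e/(\alpha_+^e+\alpha_-^e)$; for a fine edge $e\subset\partial\Omega$, $W_e=\alpha_e$, the coefficient of the adjacent fine element. **Multiscale basis functions.** For each $K\in\mathcal{T}_H$ let $\mathcal{N}^H(K)$ be its vertices. For $x_p\in\mathcal{N}^H(K)$, boundary data $\psi_{p,\partial K}$ on $\partial K$ are given that are continuous, piecewise linear w.r.t. $\mathcal{T}_h|_{\partial K}$, and satisfy $\psi_{p,\partial K}(x_{p'})=\delta_{p,p'}$ for $x_{p'}\in\mathcal{N}^H(K)$, $0\le\psi_{p,\partial K}\le1$, $\sum_{x_p\in\mathcal{N}^H(K)}\psi_{p,\partial K}=1$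 on $\partial K$, and $\psi_{p,\partial K}=0$ on the edge of $K$ opposite $x_p$. With $S^h(K)$ the continuous piecewise linear functions on $K$ w.r.t. $\mathcal{T}_h$ and $S_0^h(K)=S^h(K)\cap H_0^1(K)$, $\phi_{p,K}\in S^h(K)$ is defined by $\phi_{p,K}|_{\partial K}=\psi_{p,\partial K}$ and $\int_K\alpha\nabla\phi_{p,K}\cdot\nabla v_h\,dx=0$ for all $v_h\in S_0^h(K)$. **Multiscale DG indicator.** $\partial K_{mk}=\partial K_m\cap\partial K_k$ denotes the open edge shared by coarse elements $K_m,K_k$. $\beta(\alpha)=\max(\beta^I(\alpha),\beta^B(\alpha))$ with $$\beta^I(\alpha)=\max_{\partial K_{mk}\subset\Omega,\,m>k}\ \max_{x_p\in\mathcal{N}^H(K_m)\cap\overline{\partial K_{mk}}}\ \sum_{e\subset\partial K_{mk}}\int_e\frac{W_e}{h_e}|\phi_{p,K_m}-\phi_{p,K_k}|^2ds,$$ and $\beta^B(\alpha)$ is the maximum, over coarse edges $F\subset\partial\Omega$ (edge of $K_m$) and endpoints $x_p$ of $F$, of $\sum_{e\subset F}\int_e\frac{W_e}{h_e}|\phi_{p,K_m}|^2ds$ (sums over fine edges $e$). *)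

(* Defs.v *)
From HB Require Import structures.
From mathcomp Require Import all_boot all_order all_algebra.
From mathcomp Require Import finmap.
From mathcomp Require Import all_classical all_reals all_analysis.

Set Implicit Arguments.
Unset Strict Implicit.
Unset Printing Implicit Defensive.

Import Order.TTheory GRing.Theory Num.Theory.
Import numFieldNormedType.Exports.

Local Open Scope classical_set_scope.
Local Open Scope ring_scope.

Section Geometry.
Context {R : realType}.
Local Notation point := (R * R)%type.

(* The norm that MathComp puts on R * R is the max norm, so the Euclidean
   distance is introduced separately; the two induce the same topology. *)
Definition edist (x y : point) : R :=
  Num.sqrt ((x.1 - y.1) ^+ 2 + (x.2 - y.2) ^+ 2).

Definition closed_disc (c : point) (r : R) : set point :=
  [set x | edist c x <= r].

Definition bdry (A : set point) : set point := closure A `\` A°.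

(* Segments and triangles are given by their finite sets of vertices. *)
Definition hull (s : {fset point}) : set point :=
  [set x | exists w : point -> R,
    [/\ forall p, p \in s -> 0 <= w p,
        \sum_(p <- s) w p = 1,
        x.1 = \sum_(p <- s) w p * p.1 &
        x.2 = \sum_(p <- s) w p * p.2]].

(* Relative interior of hull s when the points of s are affinely independent:
   the open segment, the open triangle. *)
Definition ohull (s : {fset point}) : set point :=
  [set x | exists w : point -> R,
    [/\ forall p, p \in s -> 0 < w p,
        \sum_(p <- s) w p = 1,
        x.1 = \sum_(p <- s) w p * p.1 &
        x.2 = \sum_(p <- s) w p * p.2]].

Definition barycenter (s : {fset point}) : point :=
  ((#|` s|%:R)^-1 * \sum_(p <- s) p.1, (#|` s|%:R)^-1 * \sum_(p <- s) p.2).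

Definition diam (A : set point) : R :=
  sup [set d | exists x y, [/\ A x, A y & d = edist x y]].

(* Diameter of the largest disc contained in A. *)
Definition indiam (A : set point) : R :=
  2 * sup [set r | 0 <= r /\ exists c, closed_disc c r `<=` A].

(* The condition on the interior of the closure says that Omega lies on one
   side of its boundary (no slits), so that a fine edge contained in the
   boundary has exactly one adjacent element. *)
Definition polygonal_domain (Omega : set point) : Prop :=
  [/\ open Omega, connected Omega, Omega !=set0, bounded_set Omega &
      (closure Omega)° = Omega /\
      exists S : {fset {fset point}},
        (forall s, s \in S -> #|` s| = 2%N) /\
        bdry Omega = \bigcup_(s in [set` S]) hull s].

(* A conforming triangulation, as the finite set of its vertex triples. *)
Definition triangulation (Omega : set point) (T : {fset {fset point}}) : Prop :=
  [/\ forall t, t \in T -> #|` t| = 3%N /\ (hull t)° !=set0,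
      \bigcup_(t in [set` T]) hull t = closure Omega &
      forall s t, s \in T -> t \in T ->
        hull s `&` hull t = hull (s `&` t)%fset].

Definition cell_edges (t : {fset point}) : {fset {fset point}} :=
  [fset e in fpowerset t | #|` e| == 2%N]%fset.

Definition edges (T : {fset {fset point}}) : {fset {fset point}} :=
  (\bigcup_(t <- T) cell_edges t)%fset.

Definition mesh_size (T : {fset {fset point}}) : R :=
  \big[Num.max/0]_(t <- T) diam (hull t).

Definition shape_regular (sigma : R) (T : {fset {fset point}}) : Prop :=
  forall t, t \in T -> diam (hull t) <= sigma * indiam (hull t).

Definition quasi_uniform (kappa : R) (T : {fset {fset point}}) : Prop :=
  forall t, t \in T -> mesh_size T <= kappa * diam (hull t).

Definition inside (A : set point) (E : {fset {fset point}}) :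
    {fset {fset point}} :=
  [fset e in E | `[< (hull e `<=` A)%classic >]]%fset.

Definition aligned (Th TH : {fset {fset point}}) : Prop :=
  forall F, F \in edges TH ->
    \bigcup_(e in [set` inside (hull F) (edges Th)]) hull e = hull F.

(* Endpoints of an edge, in the enumeration order of the finite set. *)
Definition endp1 (e : {fset point}) : point := nth (0, 0) (enum_fset e) 0.
Definition endp2 (e : {fset point}) : point := nth (0, 0) (enum_fset e) 1.

Definition edge_length (e : {fset point}) : R := edist (endp1 e) (endp2 e).

(* Arc-length integral of g over the segment; the value does not depend on
   which endpoint comes first. *)
Definition edge_integral (e : {fset point}) (g : point -> R) : R :=
  edge_length e *
  \int[@lebesgue_measure R]_(t in `[0, 1])
    g ((1 - t) * (endp1 e).1 + t * (endp2 e).1,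
       (1 - t) * (endp1 e).2 + t * (endp2 e).2).

Definition leb2 :
    {measure set (measurableTypeR R * measurableTypeR R) -> \bar R} :=
  (@lebesgue_measure R \x @lebesgue_measure R)%E.

End Geometry.

Section Coefficient.
Context {R : realType}.
Local Notation point := (R * R)%type.

Definition Linfty (Omega : set point) (alpha : point -> R) : Prop :=
  measurable_fun (Omega : set (measurableTypeR R * measurableTypeR R)) alpha /\
  exists M : R, {ae leb2, forall x, Omega x -> `|alpha x| <= M}.

Definition piecewise_constant (Th : {fset {fset point}}) (alpha : point -> R) :
    Prop :=
  forall t, t \in Th -> exists c, forall x, ohull t x -> alpha x = c.

(* The constant value of alpha on the fine element t. *)
Definition cell_coef (alpha : point -> R) (t : {fset point}) : R :=
  alpha (barycenter t).

Definition edge_weight (Omega : set point) (Th : {fset {fset point}})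
    (alpha : point -> R) (e : {fset point}) : R :=
  let adj := enum_fset [fset t in Th | (e `<=` t)%fset]%fset in
  let a1 := cell_coef alpha (nth fset0 adj 0) in
  let a2 := cell_coef alpha (nth fset0 adj 1) in
  if `[< ohull e `<=` Omega >] then 2 * a1 * a2 / (a1 + a2) else a1.

End Coefficient.

Section MultiscaleBasis.
Context {R : realType}.
Local Notation point := (R * R)%type.

Definition affine_on (A : set point) (v : point -> R) : Prop :=
  exists a b c : R, forall x, A x -> v x = a * x.1 + b * x.2 + c.

(* fe_space is S^h(K) and fe_space0 is S_0^h(K): for continuous piecewise linear functions, membership in H^1_0
   is the vanishing of the boundary values. *)
Definition fe_space (Th : {fset {fset point}}) (K : {fset point})
    (v : point -> R) : Prop :=
  {within hull K, continuous v} /\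
  forall t, t \in inside (hull K) Th -> affine_on (hull t) v.

Definition fe_space0 (Th : {fset {fset point}}) (K : {fset point})
    (v : point -> R) : Prop :=
  fe_space Th K v /\ forall x, bdry (hull K) x -> v x = 0.

(* Scalar product of the gradients of u and v at x.  For u and v in S^h(K) the
   partial derivatives exist off the fine edges, a null set. *)
Definition grad_dot (u v : point -> R) (x : point) : R :=
  'D_((1, 0) : point) u x * 'D_((1, 0) : point) v x +
  'D_((0, 1) : point) u x * 'D_((0, 1) : point) v x.

Definition energy_form (alpha : point -> R) (K : {fset point})
    (u v : point -> R) : R :=
  \int[leb2]_(x in hull K) (alpha x * grad_dot u v x).

Definition boundary_data (Th TH : {fset {fset point}})
    (psi : {fset point} -> point -> point -> R) : Prop :=
  forall K, K \in TH ->
    (forall p, p \in K ->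
      [/\ {within bdry (hull K), continuous (psi K p)},
          forall e, e \in inside (bdry (hull K)) (edges Th) ->
            affine_on (hull e) (psi K p),
          forall q, q \in K -> psi K p q = (p == q)%:R,
          forall x, bdry (hull K) x -> 0 <= psi K p x <= 1 &
          forall x, hull (K `\ p)%fset x -> psi K p x = 0]) /\
    forall x, bdry (hull K) x -> \sum_(p <- K) psi K p x = 1.

Definition multiscale_basis (Th TH : {fset {fset point}}) (alpha : point -> R)
    (psi phi : {fset point} -> point -> point -> R) : Prop :=
  forall K p, K \in TH -> p \in K ->
    [/\ fe_space Th K (phi K p),
        forall x, bdry (hull K) x -> phi K p x = psi K p x &
        forall v, fe_space0 Th K v -> energy_form alpha K (phi K p) v = 0].

End MultiscaleBasis.

Section Indicator.
Context {R : realType}.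
Local Notation point := (R * R)%type.
Variables (Omega : set point) (Th TH : {fset {fset point}}).
Variables (alpha : point -> R) (phi : {fset point} -> point -> point -> R).

(* Weighted sum over the fine edges contained in the coarse edge F. *)
Definition edge_energy (F : {fset point}) (g : point -> R) : R :=
  \sum_(e <- inside (hull F) (edges Th))
    edge_integral e (fun x =>
      edge_weight Omega Th alpha e / edge_length e * `|g x| ^+ 2).

(* The coarse elements are numbered by their position in the enumeration of
   TH.  By conformity, two of them share an edge exactly when they have two
   common vertices, which are then its endpoints.  All the quantities maximized
   below are nonnegative, hence the default value 0. *)
Definition beta_I : R :=
  \big[Num.max/0]_(Km <- TH)
   \big[Num.max/0]_(Kk <- TH | (index Kk (enum_fset TH) <
                                index Km (enum_fset TH))%N &&
       (#|` (Km `&` Kk)%fset| == 2%N) &&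
       `[< ohull (Km `&` Kk)%fset `<=` Omega >])
    \big[Num.max/0]_(p <- (Km `&` Kk)%fset)
      edge_energy (Km `&` Kk)%fset (fun x => phi Km p x - phi Kk p x).

Definition beta_B : R :=
  \big[Num.max/0]_(Km <- TH)
   \big[Num.max/0]_(F <- cell_edges Km | `[< hull F `<=` bdry Omega >])
    \big[Num.max/0]_(p <- F)
      edge_energy F (phi Km p).

Definition beta : R := Num.max beta_I beta_B.

End Indicator.

(* Main.v *)
(* On the boundary of a coarse element the basis functions take values in
   [0, 1], so every fine edge e of a coarse edge F contributes at most W_e to
   the indicator, and it remains to bound the number of these fine edges by a
   multiple of H / h.  By conformity two of them share at most one point, and by
   shape regularity and quasi-uniformity each has length at least
   d = h / (kappa sigma); hence their midpoints are d-separated on a segment of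
   length |F| <= H, and there are at most |F| / d + 1 <= 2 |F| / d of them. *)
Require Import Defs.
From mathcomp Require Import all_boot all_order all_algebra.
From mathcomp Require Import finmap.
From mathcomp Require Import all_classical all_reals all_analysis.
From mathcomp Require Import ring lra.

Set Implicit Arguments.
Unset Strict Implicit.
Unset Printing Implicit Defensive.

Import Order.TTheory GRing.Theory Num.Theory.
Import numFieldNormedType.Exports.

Local Open Scope classical_set_scope.
Local Open Scope ring_scope.

(* all_analysis shadows this name with the extended distance. *)
Local Notation edist := Defs.edist.

(** * Barycentric coordinates and faces of triangles *)

Section Hulls.
Context {R : realType}.
Local Notation point := (R * R)%type.
Implicit Types (s t e A B : {fset point}) (x y p q r : point).

Lemma card2P e : #|` e| = 2%N -> exists a b, a != b /\ e = [fset a; b]%fset.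
Proof.
move=> e2; have /fset0Pn[a ae] : e != fset0 by rewrite -cardfs_eq0 e2.
move: e2; rewrite (cardfsD1 a) ae => -[/eqP/cardfs1P[b eb]].
exists a, b; split; last by rewrite -(fsetD1K ae) eb.
have : b \in (e `\ a)%fset by rewrite eb inE.
by rewrite !inE eq_sym => /andP[].
Qed.

Lemma card3P t p : #|` t| = 3%N -> p \in t -> exists q r,
  [/\ q != r, (t `\ p)%fset = [fset q; r]%fset &
      forall F : point -> R, \sum_(y <- t) F y = F p + (F q + F r)].
Proof.
move=> t3 pt; have : #|` (t `\ p)%fset| = 2%N by move: t3; rewrite (cardfsD1 p) pt => -[].
move=> /card2P[q [r [qr tp]]]; exists q, r; split=> // F.
by rewrite (big_fsetD1 p)//= tp big_fsetU1 ?big_seq_fset1// inE.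
Qed.

(* Vanishes on the line through q and r; its absolute value is twice the area
   of the triangle q, r, x. *)
Definition line q r x : R :=
  (q.1 - r.1) * (x.2 - r.2) - (q.2 - r.2) * (x.1 - r.1).

(** [line q r] is affine and vanishes at [q] and [r], so only the weight of [p] survives. *)
Lemma line_bary t p q r x (w : point -> R) :
  (forall F : point -> R, \sum_(y <- t) F y = F p + (F q + F r)) ->
  \sum_(y <- t) w y = 1 -> x.1 = \sum_(y <- t) w y * y.1 ->
  x.2 = \sum_(y <- t) w y * y.2 -> line q r x = w p * line q r p.
Proof.
move=> tE; rewrite !tE /line => w1 -> ->.
have -> : w p = 1 - w q - w r by lra.
by ring.
Qed.

Lemma line_hull t p q r x :
  (forall F : point -> R, \sum_(y <- t) F y = F p + (F q + F r)) ->
  hull t x -> exists2 u : R, 0 <= u <= 1 & line q r x = u * line q r p.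
Proof.
move=> tE [w [w0 w1 x1 x2]]; exists (w p); last exact: line_bary x1 x2.
(* The sum formula applied to the indicator of [z] gives a nonzero sum, which forces [z] to occur in
   [t]. *)
have mem z : [|| z == p, z == q | z == r] -> z \in t.
  move=> zpqr; have : \sum_(y <- t) (y == z)%:R != 0 :> R.
    rewrite tE lt0r_neq0//; have n0 (b : bool) : 0 <= b%:R :> R by exact: ler0n.
    have := n0 (p == z); have := n0 (q == z); have := n0 (r == z).
    by case/or3P: zpqr => /eqP->; rewrite eqxx/=; lra.
  apply: contraNT => zt; rewrite big_seq big1// => y yt.
  by case: eqP => // yz; rewrite -yz yt in zt.
have := w0 p; have := w0 q; have := w0 r; move: w1; rewrite tE.
by rewrite !mem ?eqxx ?orbT// => ? /(_ erefl)? /(_ erefl)? /(_ erefl)?; lra.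
Qed.

Lemma interior_segment (S : set point) x v : S° x ->
  exists2 eps : R, 0 < eps &
    S (x.1 + eps * v.1, x.2 + eps * v.2) /\
    S (x.1 - eps * v.1, x.2 - eps * v.2).
Proof.
move=> /nbhs_ballP[e /= e0 xe].
(* The summand 1 keeps the denominator of the step length positive even for [v = 0]. *)
have m0 : 0 < 1 + `|v.1| + `|v.2|.
  by have := normr_ge0 v.1; have := normr_ge0 v.2; lra.
have small u : u = v.1 \/ u = v.2 -> `|e / (1 + `|v.1| + `|v.2|) * u| < e.
  move=> uv; rewrite normrM gtr0_norm ?divr_gt0// -mulrA mulrC gtr_pMl//.
  rewrite mulrC ltr_pdivrMr// mul1r.
  by have := normr_ge0 v.1; have := normr_ge0 v.2; case: uv => ->; lra.
exists (e / (1 + `|v.1| + `|v.2|)); first by rewrite divr_gt0.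
have smallN u : u = v.1 \/ u = v.2 -> forall z, `|z - (z + e / (1 + `|v.1| + `|v.2|) * u)| < e
    /\ `|z - (z - e / (1 + `|v.1| + `|v.2|) * u)| < e.
  move=> uv z; rewrite opprD addNKr normrN subKr.
  by split; exact: small.
split; apply: xe; split; rewrite /= /ball/=.
- by have [] := smallN v.1 (or_introl erefl) x.1.
- by have [] := smallN v.2 (or_intror erefl) x.2.
- by have [] := smallN v.1 (or_introl erefl) x.1.
- by have [] := smallN v.2 (or_intror erefl) x.2.
Qed.

(** Moving [x] both ways along the normal of the line through [q] and [r] changes [line q r] by
    [eps * n2] up and down, yet on the hull it is a nonnegative multiple of [D]. The product form
    covers both orientations and also yields [D != 0]. *)
Lemma interior_line_gt0 t p q r x : q != r ->
  (forall F : point -> R, \sum_(y <- t) F y = F p + (F q + F r)) ->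
  (hull t)° x -> 0 < line q r p * line q r x.
Proof.
move=> qr tE xt; set D := line q r p.
have [eps eps0 [xp xm]] := interior_segment (- (q.2 - r.2), q.1 - r.1) xt.
have [u /andP[u0 _] xE] := line_hull tE (interior_subset xt).
have [up /andP[up0 _] xpE] := line_hull tE xp.
have [um /andP[um0 _] xmE] := line_hull tE xm.
rewrite -/D in xE xpE xmE.
set n2 := (q.1 - r.1) ^+ 2 + (q.2 - r.2) ^+ 2.
have n20 : 0 < n2.
  rewrite lt_neqAle addr_ge0 ?sqr_ge0// andbT eq_sym.
  apply: contraNN qr; rewrite paddr_eq0 ?sqr_ge0// !sqrf_eq0 !subr_eq0.
  by move=> /andP[/eqP h1 /eqP h2]; rewrite (surjective_pairing q) h1 h2 -surjective_pairing.
have upD : up * D = u * D + eps * n2 by rewrite -xpE -xE /line /n2/=; ring.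
have umD : um * D = u * D - eps * n2 by rewrite -xmE -xE /line /n2/=; ring.
have en : 0 < eps * n2 by rewrite mulr_gt0.
rewrite xE; have [D0|D0|D0] := ltgtP D 0.
- have : up * D <= 0 by rewrite mulr_ge0_le0// ltW.
  by move=> ?; rewrite nmulr_rgt0//; lra.
- have : 0 <= um * D by rewrite mulr_ge0// ltW.
  by move=> ?; rewrite mulr_gt0//; lra.
- by move: upD; rewrite D0 !mulr0; lra.
Qed.

(** Evaluating [line q r] at the common point gives both [w p * D] and [w' p * D], where [D] is
    nonzero because the triangle has an interior point. *)
Lemma bary_uniq t (w w' : point -> R) p :
  #|` t| = 3%N -> (hull t)° !=set0 ->
  \sum_(y <- t) w y = 1 -> \sum_(y <- t) w' y = 1 ->
  \sum_(y <- t) w y * y.1 = \sum_(y <- t) w' y * y.1 ->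
  \sum_(y <- t) w y * y.2 = \sum_(y <- t) w' y * y.2 ->
  p \in t -> w p = w' p.
Proof.
move=> t3 [c ct] w1 w'1 m1 m2 pt.
have [q [r [qr _ tE]]] := card3P t3 pt.
have /lt0r_neq0 := interior_line_gt0 qr tE ct.
rewrite mulf_eq0 negb_or => /andP[D0 _].
pose x : point := (\sum_(y <- t) w y * y.1, \sum_(y <- t) w y * y.2).
apply: (mulIf D0).
by rewrite -(@line_bary t p q r x w)// -(@line_bary t p q r x w').
Qed.

Lemma sum_extend A B (w f : point -> R) : (A `<=` B)%fset ->
  \sum_(y <- B) (if y \in A then w y else 0) * f y = \sum_(y <- A) w y * f y.
Proof.
move=> AB; rewrite -(big_fset_incl _ AB) => [|y _ /negbTE->]; last by rewrite mul0r.
by rewrite big_seq [RHS]big_seq; apply: eq_bigr => y ->.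
Qed.

Lemma sum_extend1 A B (w : point -> R) : (A `<=` B)%fset ->
  \sum_(y <- B) (if y \in A then w y else 0) = \sum_(y <- A) w y.
Proof.
move=> AB; have := @sum_extend A B w (fun=> 1) AB.
by under eq_bigr do rewrite mulr1; under [RHS]eq_bigr do rewrite mulr1.
Qed.

Lemma hull_sub A B : (A `<=` B)%fset -> hull A `<=` hull B.
Proof.
move=> AB x [w [w0 w1 x1 x2]]; exists (fun y => if y \in A then w y else 0).
rewrite !sum_extend// sum_extend1//; split=> // y _.
by case: ifP => // /w0.
Qed.

(** Extended by zero to [t], the weights from [A] and from [B] represent the same point; by
    uniqueness those from [A] vanish off [B]. *)
Lemma hullI_cell t A B : #|` t| = 3%N -> (hull t)° !=set0 ->
  (A `<=` t)%fset -> (B `<=` t)%fset ->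
  hull A `&` hull B `<=` hull (A `&` B)%fset.
Proof.
move=> t3 t0 At Bt x [[w [w0 w1 x1 x2]] [w' [w'0 w'1 x'1 x'2]]].
have w_out y : y \in A -> y \notin (A `&` B)%fset -> w y = 0.
  move=> yA; rewrite inE yA/= => yB.
  have := @bary_uniq t (fun y => if y \in A then w y else 0)
    (fun y => if y \in B then w' y else 0) y t3 t0.
  rewrite !sum_extend// !sum_extend1// yA (negbTE yB); apply => //.
  - by rewrite -x1.
  - by rewrite -x2.
  - exact: (fsubsetP At).
have sAB : (A `&` B `<=` A)%fset by rewrite fsubsetIl.
have sub (f : point -> R) : \sum_(y <- (A `&` B)%fset) w y * f y = \sum_(y <- A) w y * f y.
  by apply: big_fset_incl => // y yA /w_out->//; rewrite mul0r.
exists w; split.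
- by move=> y /(fsubsetP sAB)/w0.
- by rewrite (big_fset_incl _ sAB).
- by rewrite sub.
- by rewrite sub.
Qed.

Lemma hull_subset1 A x y : (#|` A| <= 1)%N -> hull A x -> hull A y -> x = y.
Proof.
rewrite leq_eqVlt ltnS leqn0 => /orP[/cardfs1P[a ->]|].
  move=> [w [_ + + +]] [w' [_ + + +]]; rewrite !big_seq_fset1.
  case: x y => [x1 x2] [y1 y2]/= w1 -> -> w'1 -> ->.
  by rewrite w1 w'1.
rewrite cardfs_eq0 => /eqP-> [w [_ + _ _]].
by rewrite big_seq_fset0 => /eqP; rewrite eq_sym oner_eq0.
Qed.

(** Points of the side have weight 0 at the opposite vertex [p], so [line q r] vanishes there,
    whereas it is nonzero in the interior. *)
Lemma closed_edge_bdry t A : #|` t| = 3%N -> (A `<=` t)%fset -> #|` A| = 2%N ->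
  hull A `<=` bdry (hull t).
Proof.
move=> t3 At A2 x Ax; split; first exact/subset_closure/(hull_sub At).
move=> xt.
have [p pt pA] : exists2 p, p \in t & p \notin A.
  have : (t `\` A)%fset != fset0 by rewrite -cardfs_eq0 cardfsDS// t3 A2.
  by move=> /fset0Pn[p]; rewrite inE => /andP[? ?]; exists p.
have [q [r [qr _ tE]]] := card3P t3 pt.
have := interior_line_gt0 qr tE xt.
have [w [w0 w1 x1 x2]] := Ax.
rewrite (@line_bary t p q r x (fun y => if y \in A then w y else 0))//.
- by rewrite (negbTE pA) mul0r mulr0 ltxx.
- by rewrite sum_extend1.
- by rewrite sum_extend.
- by rewrite sum_extend.
Qed.

Lemma edgesP (T : {fset {fset point}}) e : 
  reflect (exists t, [/\ t \in T, (e `<=` t)%fset & #|` e| = 2%N])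
  (e \in edges T).
Proof.
apply: (iffP (bigfcupP _ _ _ _)) => [[t]|[t [tT et e2]]].
  rewrite andbT => tT; rewrite !inE fpowersetE => /andP[et /eqP e2].
  by exists t.
by exists t; rewrite ?tT// !inE fpowersetE et e2/=.
Qed.

(** Conformity places a common point in the hull of the vertices shared by the two cells;
    intersecting with [e] inside one cell and [e'] inside the other leaves at most one common
    vertex. *)
Lemma edges_meet (Omega : set point) T e e' x y : triangulation Omega T ->
  e \in edges T -> e' \in edges T -> e != e' ->
  hull e x -> hull e' x -> hull e y -> hull e' y -> x = y.
Proof.
move=> [T3 _ Tc] /edgesP[s [sT es e2]] /edgesP[t [tT et e'2]] ee'.
have [s3 s0] := T3 s sT; have [t3 t0] := T3 t tT.
have hI : hull e `&` hull e' `<=` hull (e `&` e')%fset.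
  move=> z [ze ze'].
  have zst : hull (s `&` t)%fset z.
    by rewrite -Tc//; split; [exact: hull_sub ze|exact: hull_sub ze'].
  have zet : hull (e `&` (s `&` t))%fset z.
    by apply: (hullI_cell s3 s0) => //; rewrite fsubsetIl.
  have : hull ((e `&` (s `&` t)) `&` e')%fset z.
    by apply: (hullI_cell t3 t0) => //; rewrite fsetIA fsubsetIr.
  by apply: hull_sub; rewrite fsetIAC fsubsetIl.
move=> ex e'x ey e'y; apply: (@hull_subset1 (e `&` e')%fset); do ?exact: hI.
rewrite -ltnS -e2 -[X in (X < _)%N]/(#|` _|).
apply: fproper_ltn_card; rewrite fproperEneq fsubsetIl andbT.
apply: contraNN ee' => /eqP/fsetIidPl ee'.
by rewrite -(fsubset_leqif_cards ee') e2 e'2.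
Qed.


(** * Euclidean lengths, diameters and inscribed discs *)

Lemma edist_ge0 x y : 0 <= edist x y. Proof. exact: sqrtr_ge0. Qed.

Lemma edist_sqr x y : edist x y ^+ 2 = (x.1 - y.1) ^+ 2 + (x.2 - y.2) ^+ 2.
Proof. by rewrite sqr_sqrtr// addr_ge0// sqr_ge0. Qed.

Lemma edistC x y : edist x y = edist y x.
Proof. by rewrite /edist -(sqrrN (x.1 - _)) -(sqrrN (x.2 - _)) !opprB. Qed.

Lemma edist_gt0 x y : x != y -> 0 < edist x y.
Proof.
move=> xy; rewrite lt_neqAle edist_ge0 andbT eq_sym -sqrf_eq0 edist_sqr.
apply: contraNN xy; rewrite paddr_eq0 ?sqr_ge0// !sqrf_eq0 !subr_eq0.
by case: x y => [x1 x2] [y1 y2] /= /andP[/eqP-> /eqP->].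
Qed.

Lemma edist_le_diam t x y : hull t x -> hull t y -> edist x y <= diam (hull t).
Proof.
move=> xt yt; apply: sup_upper_bound; last by exists x, y.
split; first by exists (edist x y), x, y.
(* The supremum defining [diam] bounds its elements only if the set of distances is bounded; [M]
   bounds each coordinate on the hull. *)
pose M (f : point -> R) := \sum_(p <- t) `|f p|.
have bnd (f : point -> R) (w : point -> R) :
    (forall p, p \in t -> 0 <= w p) -> \sum_(p <- t) w p = 1 ->
    `|\sum_(p <- t) w p * f p| <= M f.
  move=> w0 w1; apply: (le_trans (ler_norm_sum _ _ _)).
  rewrite /M big_seq [leRHS]big_seq; apply: ler_sum => p pt.
  rewrite normrM (ger0_norm (w0 _ pt)) ler_piMl// -w1.
  rewrite (big_fsetD1 p)//= lerDl big_seq sumr_ge0// => q.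
  by rewrite !inE => /andP[_ /w0].
exists (2 * (M fst + M snd)) => _ [x' [y' [x't y't ->]]].
have [w [w0 w1 x1 x2]] := x't; have [v [v0 v1 y1 y2]] := y't.
have hx1 := bnd fst _ w0 w1; have hx2 := bnd snd _ w0 w1.
have hy1 := bnd fst _ v0 v1; have hy2 := bnd snd _ v0 v1.
rewrite -x1 -x2 -y1 -y2 in hx1 hx2 hy1 hy2.
have d1 := ler_normB x'.1 y'.1; have d2 := ler_normB x'.2 y'.2.
apply: (@le_trans _ _ (`|x'.1 - y'.1| + `|x'.2 - y'.2|)); last by lra.
rewrite -(@ler_pXn2r _ 2)// ?nnegrE ?edist_ge0 ?addr_ge0// edist_sqr.
rewrite [leRHS]sqrrD !real_normK ?num_real// addrAC lerDl.
by rewrite mulrn_wge0// mulr_ge0.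
Qed.

Lemma hull_vertex t p : p \in t -> hull t p.
Proof.
move=> pt; apply: (@hull_sub [fset p]%fset); first by rewrite fsub1set.
by exists (fun=> 1); rewrite !big_seq_fset1 !mul1r; split.
Qed.

(** By Lagrange's identity the squares of the two sides differ by a squared scalar product. *)
Lemma line_le q r x : `|line q r x| <= edist q r * edist x r.
Proof.
rewrite -(@ler_pXn2r _ 2)// ?nnegrE ?mulr_ge0 ?edist_ge0//.
rewrite real_normK ?num_real// exprMn !edist_sqr /line -subr_ge0.
set u := q.1 - r.1; set v := q.2 - r.2; set a := x.1 - r.1; set b := x.2 - r.2.
rewrite (_ : _ - _ = (u * a + v * b) ^+ 2) ?sqr_ge0//; ring.
Qed.

Lemma line_flip q r x : line q r x = - line r q x.
Proof. by rewrite /line; ring. Qed.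

(* A disc in the triangle is no wider than the height from q, itself at most the
   length of either side through q. *)
Lemma indiam_le_side t q r : #|` t| = 3%N -> q \in t -> r \in t -> q != r ->
  indiam (hull t) <= edist q r.
Proof.
move=> t3 qt rt qr; have [a [b [ab tq tE]]] := card3P t3 qt.
have : r \in [fset a; b]%fset by rewrite -tq !inE eq_sym qr.
move=> rab; have D_le : `|line a b q| <= edist a b * edist q r.
  by move: rab; rewrite !inE => /orP[] /eqP->;
     [rewrite line_flip normrN edistC|];
     exact: line_le.
have L0 := edist_gt0 ab; set L := edist a b in D_le L0.
rewrite /indiam mulrC -ler_pdivlMr//.
set S := [set _ | _]; have S0 : S !=set0.
  exists 0; split=> //; exists q => x; rewrite /closed_disc/= => xq.
  suff <- : q = x by exact: hull_vertex.
  by apply/eqP; apply: contraLR xq => /edist_gt0; rewrite ltNge.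
apply: ge_sup => // rad [rad0 [c cS]].
(* [v] is normal to the side [a], [b] and has length [L], so shifting [c] by [k] or [- k] times [v]
   reaches the ends of a diameter. There [line a b] differs by [2 * rad * L], but by at most its
   absolute value at [q]. *)
pose v : point := (- (a.2 - b.2), a.1 - b.1).
pose k := rad / L.
have k0 : 0 <= k by rewrite divr_ge0// ltW.
have kin z : z = k \/ z = - k -> hull t (c.1 + z * v.1, c.2 + z * v.2).
  move=> zk; apply: cS; rewrite /closed_disc/=.
  rewrite -(@ler_pXn2r _ 2)// ?nnegrE ?edist_ge0// edist_sqr/=.
  have -> : rad ^+ 2 = k ^+ 2 * L ^+ 2 by rewrite -exprMn divfK// gt_eqF.
  rewrite edist_sqr le_eqVlt; apply/orP; left; apply/eqP.
  by case: zk => ->; ring.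
have [u u01 uE] := line_hull tE (kin k (or_introl erefl)).
have [u' u'01 u'E] := line_hull tE (kin (- k) (or_intror erefl)).
have eqL : 2 * rad * L = (u - u') * line a b q.
  rewrite mulrBl -uE -u'E.
  have -> : rad = k * L by rewrite divfK// gt_eqF.
  rewrite -mulrA -mulrA -expr2 edist_sqr /line/=; ring.
have : 2 * rad * L <= `|line a b q|.
  apply: (le_trans (ler_norm _)); rewrite eqL normrM ler_piMl//.
  by rewrite ler_norml; lra.
move=> /le_trans /(_ D_le); rewrite (mulrC L) ler_pM2r// => h.
by rewrite ler_pdivlMr// mulrC.
Qed.

Lemma endp_neq e : #|` e| = 2%N ->
  endp1 e != endp2 e /\ e = [fset endp1 e; endp2 e]%fset.
Proof.
rewrite /endp1 /endp2 => e2; have e12 : nth (0, 0) (enum_fset e) 0 != nth (0, 0) (enum_fset e) 1.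
  by rewrite nth_uniq ?fset_uniq// -[size _]/(#|` e|) e2.
split=> //; apply/esym/eqP.
rewrite eqEfcard cardfs2 e12 e2 leqnn andbT.
by apply/fsubsetP => z; rewrite !inE => /orP[] /eqP->;
  apply: mem_nth; rewrite -[size _]/(#|` e|) e2.
Qed.

Lemma hull_pair p q (t : R) : p != q -> 0 <= t <= 1 ->
  hull [fset p; q]%fset ((1 - t) * p.1 + t * q.1, (1 - t) * p.2 + t * q.2).
Proof.
move=> pq /andP[t0 t1]; exists (fun z => if z == p then 1 - t else t).
have sE (f : point -> R) : \sum_(y <- [fset p; q]%fset) f y = f p + f q.
  by rewrite big_fsetU1 ?big_seq_fset1// inE.
rewrite !sE eqxx eq_sym (negbTE pq)/=; split=> //; last by rewrite subrK.
by move=> z _; case: ifP => // _; rewrite subr_ge0.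
Qed.

Lemma hull_pairP p q x : p != q -> hull [fset p; q]%fset x -> exists2 t : R, 0 <= t <= 1 &
  x = ((1 - t) * p.1 + t * q.1, (1 - t) * p.2 + t * q.2).
Proof.
move=> pq [w [w0 + + +]].
have sE (f : point -> R) : \sum_(y <- [fset p; q]%fset) f y = f p + f q.
  by rewrite big_fsetU1 ?big_seq_fset1// inE.
rewrite !sE => w1 x1 x2; exists (w q).
  have := w0 p; have := w0 q; rewrite !inE !eqxx orbT => /(_ erefl)? /(_ erefl)?; lra.
have -> : 1 - w q = w p by lra.
by rewrite -x1 -x2 -surjective_pairing.
Qed.

End Hulls.

(** * Counting fine edges on a segment *)

Lemma separated_card (R : archiRealFieldType) (K : choiceType) (E : {fset K}) (m : K -> R) (L d : R) :
  0 < d -> 0 <= L -> (forall e, e \in E -> 0 <= m e <= L) ->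
  (forall e e', e \in E -> e' \in E -> e != e' -> d <= `|m e - m e'|) ->
  #|` E|%:R * d <= L + d.
Proof.
(* Pigeonhole: each half-open interval of length [d] contains at most one value of [m]. The interval
   numbers start at 0, whence the extra [d] in the bound. *)
move=> d0 L0 mL sep; pose f e := Num.truncn (m e / d).
have f_itv e : e \in E -> (f e)%:R <= m e / d < (f e).+1%:R.
  by move=> /mL/andP[m0 _]; apply: truncn_itv; rewrite divr_ge0// ltW.
have f_inj : {in E &, injective f}.
  move=> e e' eE e'E fe; apply/eqP; apply: contraT => ee'.
  have := sep _ _ eE e'E ee'; rewrite leNgt => /negP[].
  move: (f_itv _ eE) (f_itv _ e'E); rewrite -fe -natr1.
  rewrite !(ler_pdivlMr, ltr_pdivrMr)// ltr_norml mulrDl mul1r.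
  by move=> /andP[? ?] /andP[? ?]; lra.
have fE : (size (map f (enum_fset E)) <= size (iota 0 (Num.truncn (L / d)).+1))%N.
  apply: uniq_leq_size; first by rewrite map_inj_in_uniq ?fset_uniq.
  move=> _ /mapP[e eE ->]; rewrite mem_iota add0n ltnS /f.
  have /andP[m0 mL'] := mL _ eE.
  by apply: le_truncn; rewrite ler_pM2r ?invr_gt0.
move: fE; rewrite size_map size_iota => fE.
apply: (@le_trans _ _ ((Num.truncn (L / d)).+1%:R * d)).
  by rewrite ler_pM2r// ler_nat.
rewrite -natr1 mulrDl mul1r lerD2r -ler_pdivlMr//.
by have /andP[] := @truncn_itv _ (L / d) (divr_ge0 L0 (ltW d0)).
Qed.

Section Counting.
Context {R : realType}.
Local Notation point := (R * R)%type.
Implicit Types (e : {fset point}) (x y p q r : point).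

Section Segment.
Variables a b : point.
Hypothesis ab : a != b.
Let L := edist a b.
Let L_gt0 : 0 < L. Proof. exact: edist_gt0. Qed.

(** Arc-length parametrization from [a]. Its inverse [arc] is the coordinate of the orthogonal
    projection, so edges in the segment become intervals of [[0, L]]. *)
Let at_arc (s : R) : point :=
  ((1 - s / L) * a.1 + s / L * b.1, (1 - s / L) * a.2 + s / L * b.2).

Let arc x : R := ((x.1 - a.1) * (b.1 - a.1) + (x.2 - a.2) * (b.2 - a.2)) / L.

Let at_arcK s : arc (at_arc s) = s.
Proof.
rewrite /arc /at_arc/=; apply: (mulIf (lt0r_neq0 L_gt0)).
rewrite divfK ?gt_eqF//.
transitivity (s / L * L ^+ 2); last by rewrite expr2 mulrA divfK ?gt_eqF.
by rewrite edist_sqr; ring.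
Qed.

Let arcK x : hull [fset a; b]%fset x -> 0 <= arc x <= L /\ at_arc (arc x) = x.
Proof.
move=> /(hull_pairP ab)[t t01 xE].
have {}xE : x = at_arc (t * L) by rewrite /at_arc mulfK ?gt_eqF.
split; last by rewrite xE at_arcK.
rewrite xE at_arcK; have /andP[t0 t1] := t01.
by rewrite mulr_ge0 ?(ltW L_gt0)//= ler_piMl// ltW.
Qed.

Let edist_at_arc s s' : edist (at_arc s) (at_arc s') = `|s - s'|.
Proof.
apply: (pexpIrn (n := 2)); rewrite ?nnegrE ?edist_ge0 ?normr_ge0//.
rewrite edist_sqr real_normK ?num_real//.
have -> : s - s' = (s / L - s' / L) * L by rewrite -mulrBl divfK// gt_eqF.
by rewrite exprMn edist_sqr /at_arc/=; ring.
Qed.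

Let mid e : R := (arc (endp1 e) + arc (endp2 e)) / 2.

Let hull_around_mid e s : #|` e| = 2%N -> hull e `<=` hull [fset a; b]%fset ->
  `|s - mid e| <= edge_length e / 2 -> hull e (at_arc s).
Proof.
move=> e2 eab; have [e12 eE] := endp_neq e2.
have [_ K1] : 0 <= arc (endp1 e) <= L /\ at_arc (arc (endp1 e)) = endp1 e.
  by apply/arcK/eab/hull_vertex; rewrite {2}eE !inE eqxx.
have [_ K2] : 0 <= arc (endp2 e) <= L /\ at_arc (arc (endp2 e)) = endp2 e.
  by apply/arcK/eab/hull_vertex; rewrite {2}eE !inE eqxx orbT.
have -> : edge_length e = `|arc (endp1 e) - arc (endp2 e)|.
  by rewrite -edist_at_arc K1 K2.
rewrite /mid.
set u := arc (endp1 e) in K1 *; set v := arc (endp2 e) in K2 * => s_uv.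
have uv : v - u != 0.
  by apply: contraNN e12; rewrite -K1 -K2 subr_eq0 => /eqP->.
rewrite {1}eE; have -> : at_arc s =
    ((1 - (s - u) / (v - u)) * (endp1 e).1 + (s - u) / (v - u) * (endp2 e).1,
     (1 - (s - u) / (v - u)) * (endp1 e).2 + (s - u) / (v - u) * (endp2 e).2).
  rewrite -K1 -K2 /at_arc/=; have := lt0r_neq0 L_gt0.
  by move=> L0; congr (_, _); field; rewrite uv L0.
apply: hull_pair => //; move: s_uv; rewrite ler_norml => s_uv.
(* The enumeration of [e] may run either way along the segment. *)
have [uv'|uv'] := leP u v.
  have vu0 : 0 < v - u by rewrite lt_neqAle eq_sym uv subr_ge0.
  move: s_uv; rewrite distrC gtr0_norm// => s_uv.
  by rewrite ler_pdivlMr// ler_pdivrMr//; lra.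
have vu0 : v - u < 0 by rewrite subr_lt0.
move: s_uv; rewrite gtr0_norm ?subr_gt0// => s_uv.
by rewrite ler_ndivlMr// ler_ndivrMr//; lra.
Qed.

(** If two midpoints were closer than [d], both edges would contain the points at [m] and [m + h],
    contradicting [edges_meet]. *)
Lemma edges_on_segment_card (Omega : set point) (T E : {fset {fset point}}) (d : R) :
  triangulation Omega T -> 0 < d ->
  (forall e, e \in E ->
    [/\ e \in edges T, hull e `<=` hull [fset a; b]%fset & d <= edge_length e]) ->
  #|` E|%:R * d <= 2 * edist a b.
Proof.
move=> OT d0 Ed; have e2 e : e \in E -> #|` e| = 2%N.
  by move=> /Ed[/edgesP[t []]].
have earc e : e \in E -> [/\ 0 <= arc (endp1 e) <= L, 0 <= arc (endp2 e) <= L &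
    edge_length e = `|arc (endp1 e) - arc (endp2 e)|].
  move=> eE; have [_ eab _] := Ed _ eE; have [_ eE'] := endp_neq (e2 _ eE).
  have [i1 K1] : 0 <= arc (endp1 e) <= L /\ at_arc (arc (endp1 e)) = endp1 e.
    by apply/arcK/eab/hull_vertex; rewrite {2}eE' !inE eqxx.
  have [i2 K2] : 0 <= arc (endp2 e) <= L /\ at_arc (arc (endp2 e)) = endp2 e.
    by apply/arcK/eab/hull_vertex; rewrite {2}eE' !inE eqxx orbT.
  by split; rewrite // -edist_at_arc K1 K2.
have [->|/fset0Pn[e0 e0E]] := eqVneq E fset0.
  by rewrite cardfs0 mul0r mulr_ge0// edist_ge0.
have dL : d <= L.
  have [_ _] := Ed _ e0E; have [? ? ->] := earc _ e0E.
  by move=> /le_trans; apply; rewrite ler_norml; lra.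
(* Since one edge of length at least [d] fits into the segment, [L + d <= 2 * L]. *)
suff : #|` E|%:R * d <= L + d by rewrite -/L; lra.
apply: (@separated_card R _ E mid) => //; first exact: ltW.
  by move=> e /earc[? ? _]; rewrite /mid; lra.
move=> e e' eE e'E ee'; rewrite leNgt; apply/negP => close.
have [eT eab de] := Ed _ eE; have [e'T e'ab de'] := Ed _ e'E.
have inter s : `|s - (mid e + mid e') / 2| <= (d - `|mid e - mid e'|) / 2 ->
    hull e (at_arc s) /\ hull e' (at_arc s).
  move=> sm; have : `|s - mid e| <= d / 2 /\ `|s - mid e'| <= d / 2.
    move: sm; rewrite !ler_norml; have := ler_norm (mid e - mid e').
    by have := ler_norm (mid e' - mid e); rewrite distrC; lra.
  by case=> h h'; split; apply: hull_around_mid; rewrite ?e2//; lra.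
pose h := (d - `|mid e - mid e'|) / 2; pose m := (mid e + mid e') / 2.
have h0 : 0 < h by rewrite divr_gt0// subr_gt0.
have [|x1 x2] := inter (m + h); first by rewrite -/m addrAC subrr add0r gtr0_norm.
have [|y1 y2] := inter m; first by rewrite -/m subrr normr0 ltW.
have /(congr1 arc) := edges_meet OT eT e'T ee' x1 x2 y1 y2.
by rewrite !at_arcK; lra.
Qed.
End Segment.
End Counting.

(** * Bounds for the weighted energy on one coarse edge *)

Section EdgeEnergy.
Context {R : realType}.
Local Notation point := (R * R)%type.

(* No measurability is required of [f]: the integral is defined through simple
   functions below the positive and negative parts. *)
Lemma Rintegral_itv01_le (f : R -> R) (M : R) : 0 <= M ->
  (forall t, 0 <= t <= 1 -> f t <= M) ->
  \int[@lebesgue_measure R]_(t in `[0, 1]) f t <= M.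
Proof.
move=> M0 fM; rewrite /Rintegral.
suff : (\int[@lebesgue_measure R]_(t in `[0%R, 1%R]) (f t)%:E <= M%:E)%E.
  by case: (integral _ _ _) => [r| |]; rewrite ?lee_fin.
have cstM : (\int[@lebesgue_measure R]_(t in `[0%R, 1%R]) M%:E = M%:E)%E.
  by rewrite integral_cst//= lebesgue_measure_itv/= lte_fin ltr01 oppr0 adde0 mule1.
rewrite -[leRHS]cstM integralE.
apply: (@le_trans _ _ (\int[@lebesgue_measure R]_(t in `[0%R, 1%R]) ((EFin \o f)^\+ t))%E).
  by rewrite geeDl// oppe_le0 integral_ge0.
rewrite ge0_integralE// ge0_integralE//.
apply: ge_ereal_sup => _ [g gf <-]; apply: ereal_sup_ubound; exists g => // t.
apply: (le_trans (gf t)); rewrite !patchE; case: ifPn => // /set_mem/=.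
rewrite in_itv/= => /fM ftM; by rewrite funeposE/= -EFin_max lee_fin ge_max ftM.
Qed.

Lemma edge_integral_le (e : {fset point}) (g : point -> R) (w B : R) :
  #|` e| = 2%N -> 0 <= B -> w <= B -> (forall x, hull e x -> `|g x| <= 1) ->
  edge_integral e (fun x => w / edge_length e * `|g x| ^+ 2) <= B.
Proof.
move=> e2 B0 wB g1; have [e12 eE] := endp_neq e2.
have l0 : 0 < edge_length e by exact: edist_gt0.
rewrite /edge_integral mulrC -ler_pdivlMr//.
apply: Rintegral_itv01_le => [|t t01]; first by rewrite divr_ge0// ltW.
have : hull e ((1 - t) * (endp1 e).1 + t * (endp2 e).1,
               (1 - t) * (endp1 e).2 + t * (endp2 e).2).
  by rewrite {1}eE; exact: hull_pair.
move=> /g1; set y := g _ => y1.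
have y21 : 0 <= `|y| ^+ 2 <= 1 by rewrite exprn_ge0//= expr_le1.
rewrite mulrAC ler_pM2r ?invr_gt0//.
have [w0|w0] := leP 0 w; first by apply: le_trans wB; rewrite ler_piMr//; lra.
by apply: le_trans B0; rewrite mulr_le0_ge0 ?(ltW w0)//; lra.
Qed.

Lemma mesh_size_ge0 (T : {fset {fset point}}) : 0 <= mesh_size T.
Proof. exact: bigmax_ge_id. Qed.

Lemma diam_le_mesh_size (T : {fset {fset point}}) t :
  t \in T -> diam (hull t) <= mesh_size T.
Proof. by move=> tT; apply: (@le_bigmax_seq _ _ _ _ 0 t xpredT). Qed.

Lemma mesh_size_gt0 (Omega : set point) (T : {fset {fset point}}) e :
  triangulation Omega T -> e \in edges T -> 0 < mesh_size T.
Proof.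
move=> [T3 _ _] /edgesP[t [tT et e2]]; have [p [q [pq eE]]] := card2P e2.
apply: lt_le_trans (diam_le_mesh_size tT); apply: lt_le_trans (edist_gt0 pq) _.
by apply: edist_le_diam; apply: hull_vertex; apply: (fsubsetP et);
  rewrite eE !inE eqxx ?orbT.
Qed.

(** Quasi-uniformity passes from [h] to the diameter of a cell, shape regularity to its inscribed
    disc, and [indiam_le_side] to the edge. *)
Lemma mesh_size_le_edge (Omega : set point) (T : {fset {fset point}})
    (sigma kappa : R) e :
  0 < sigma -> 0 < kappa -> triangulation Omega T -> shape_regular sigma T ->
  quasi_uniform kappa T -> e \in edges T ->
  mesh_size T <= kappa * sigma * edge_length e.
Proof.
move=> s0 k0 [T3 _ _] Ts Tk /edgesP[t [tT et e2]].
apply: (le_trans (Tk _ tT)); rewrite -mulrA ler_pM2l//.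
apply: (le_trans (Ts _ tT)); rewrite ler_pM2l//.
have [e12 eE] := endp_neq e2.
have [t3 _] := T3 _ tT.
have e1t : endp1 e \in t by apply: (fsubsetP et); rewrite {2}eE !inE eqxx.
have e2t : endp2 e \in t by apply: (fsubsetP et); rewrite {2}eE !inE eqxx orbT.
exact: indiam_le_side.
Qed.

Lemma edge_energy_le (Omega : set point) (Th TH : {fset {fset point}})
    (alpha g : point -> R) (sigma kappa B : R) (K F : {fset point}) :
  0 < sigma -> 0 < kappa -> 0 <= B ->
  triangulation Omega Th -> shape_regular sigma Th -> quasi_uniform kappa Th ->
  K \in TH -> (F `<=` K)%fset -> #|` F| = 2%N ->
  (forall e, e \in inside (hull F) (edges Th) -> edge_weight Omega Th alpha e <= B) ->
  (forall x, hull F x -> `|g x| <= 1) ->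
  edge_energy Omega Th alpha F g <=
    B * (2 * (kappa * sigma) * (mesh_size TH / mesh_size Th)).
Proof.
move=> s0 k0 B0 OTh Ths Thk KTH FK F2 WB g1.
set E := inside (hull F) (edges Th) in WB *.
have insE e : e \in E -> e \in edges Th /\ hull e `<=` hull F.
  by rewrite !inE => /andP[? /asboolP].
have ks0 : 0 < kappa * sigma by rewrite mulr_gt0.
apply: (@le_trans _ _ (B * #|` E|%:R)).
  rewrite mulr_natr /edge_energy -/E.
  have -> : B *+ #|` E| = \sum_(e <- E) B.
    by rewrite big_const_seq count_predT iter_addr addr0.
  rewrite big_seq [leRHS]big_seq; apply: ler_sum => e eE.
  have [eT eF] := insE _ eE; apply: edge_integral_le => //.
  - by have /edgesP[t []] := eT.
  - exact: WB.
  - by move=> x /eF/g1.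
apply: ler_wpM2l => //.
(* A fine edge is what guarantees a positive mesh size; without one the count is 0. *)
have [->|/fset0Pn[e0 e0E]] := eqVneq E fset0.
  rewrite cardfs0 mulr_ge0// ?divr_ge0 ?mesh_size_ge0//.
  by rewrite mulr_ge0// ltW.
have h0 := mesh_size_gt0 OTh (insE _ e0E).1.
have [a [b [ab FE]]] := card2P F2.
have := @edges_on_segment_card _ _ _ ab _ _ E (mesh_size Th / (kappa * sigma)) OTh.
have hks0 : 0 < mesh_size Th / (kappa * sigma) by rewrite divr_gt0.
move=> /(_ hks0) cnt; rewrite -(ler_pM2r hks0).
(* Multiplied by the minimal edge length [h / (kappa * sigma)], the claim becomes a bound by
   [2 * H]. *)
have -> : 2 * (kappa * sigma) * (mesh_size TH / mesh_size Th) *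
    (mesh_size Th / (kappa * sigma)) = 2 * mesh_size TH.
  by field; rewrite ?mulf_neq0 ?gt_eqF.
apply: (le_trans (cnt _)).
  move=> e eE; have [eT eF] := insE _ eE; rewrite -FE; split=> //.
  by rewrite ler_pdivrMr// mulrC (mesh_size_le_edge s0 k0 OTh).
rewrite ler_pM2l//; apply: le_trans (diam_le_mesh_size KTH).
by apply: edist_le_diam; apply: hull_vertex; apply: (fsubsetP FK);
  rewrite FE !inE eqxx ?orbT.
Qed.

Lemma bigmax_seq_le (I : eqType) (r : seq I) (P : pred I) (F : I -> R) (M : R) :
  0 <= M -> (forall i, i \in r -> P i -> F i <= M) ->
  \big[Num.max/0]_(i <- r | P i) F i <= M.
Proof.
by move=> M0 FM; rewrite big_seq_cond; apply: bigmax_le => // i /andP[]; exact: FM.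
Qed.

End EdgeEnergy.

(* The hidden constants: C may depend on the shape-regularity and
   quasi-uniformity constants of the two meshes and on the constant c hidden in
   the hypothesis on W_e, and on nothing else. *)
Theorem theorem3p4 (R : realType) (sigma kappa c : R)
    (sigma_gt0 : 0 < sigma) (kappa_gt0 : 0 < kappa) (c_gt0 : 0 < c) :
  exists2 C : R, 0 < C &
    forall (Omega : set (R * R)) (Th TH : {fset {fset (R * R)}})
      (alpha : R * R -> R) (alpha0 : R)
      (psi phi : {fset (R * R)} -> R * R -> R * R -> R) (rho : R),
    polygonal_domain Omega ->
    triangulation Omega Th ->
    shape_regular sigma Th ->
    quasi_uniform kappa Th ->
    triangulation Omega TH ->
    shape_regular sigma TH ->
    quasi_uniform kappa TH ->
    aligned Th TH ->
    Linfty Omega alpha ->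
    piecewise_constant Th alpha ->
    0 < alpha0 ->
    (forall x, Omega x -> alpha0 <= alpha x) ->
    boundary_data Th TH psi ->
    multiscale_basis Th TH alpha psi phi ->
    0 < rho ->
    (forall K e, K \in TH -> e \in inside (bdry (hull K)) (edges Th) ->
      edge_weight Omega Th alpha e <= c * rho) ->
    beta Omega Th TH alpha phi <= C * (rho * (mesh_size TH / mesh_size Th)).
Proof.
(* Each fine edge contributes at most [c * rho], and a coarse edge contains at most
   [2 * (kappa * sigma) * (H / h)] of them. *)
exists (2 * c * (kappa * sigma)); first by rewrite !mulr_gt0.
move=> Omega Th TH alpha _ psi phi rho _ OTh Ths Thk [TH3 _ _] _ _ _ _ _ _ _.
move=> bd mb rho0 We; set M := _ * (rho * _).
have B0 : 0 <= c * rho by rewrite mulr_ge0// ltW.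
have ME : M = c * rho * (2 * (kappa * sigma) * (mesh_size TH / mesh_size Th)).
  by rewrite /M; ring.
(* The iterated maxima have default value 0, which must also lie below [M]. *)
have M0 : 0 <= M.
  by rewrite ME mulr_ge0// !mulr_ge0 ?invr_ge0 ?mesh_size_ge0// ltW.
have phi01 K p x : K \in TH -> p \in K -> bdry (hull K) x -> 0 <= phi K p x <= 1.
  move=> KTH pK xK; have [_ -> // _] := mb K p KTH pK.
  by have [+ _] := bd K KTH => /(_ p pK)[_ _ _ + _]; exact.
have F_bdry K F : K \in TH -> (F `<=` K)%fset -> #|` F| = 2%N ->
    hull F `<=` bdry (hull K).
  by move=> KTH FK F2; apply: closed_edge_bdry => //; have [] := TH3 K KTH.
have energy_le K F g : K \in TH -> (F `<=` K)%fset -> #|` F| = 2%N ->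
    (forall x, hull F x -> `|g x| <= 1) -> edge_energy Omega Th alpha F g <= M.
  move=> KTH FK F2 g1; rewrite ME.
  apply: (@edge_energy_le R Omega Th TH _ _ _ _ _ K) => // e.
  rewrite !inE => /andP[eT /asboolP eF]; apply: (We K) => //.
  by rewrite !inE eT; apply/asboolP/(subset_trans eF)/F_bdry.
rewrite /beta ge_max; apply/andP; split.
- apply: bigmax_seq_le => // Km KmT _; apply: bigmax_seq_le => // Kk KkT.
  move=> /andP[/andP[_ /eqP F2] _]; apply: bigmax_seq_le => // p + _.
  rewrite inE => /andP[pm pk].
  have [sm sk] : (Km `&` Kk `<=` Km)%fset /\ (Km `&` Kk `<=` Kk)%fset.
    by rewrite fsubsetIl fsubsetIr.
  (* The jump is a difference of two numbers in [[0, 1]], since the shared edge lies on both cell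
     boundaries. *)
  apply: (energy_le Km) => // x xF; rewrite ler_norml.
  have := phi01 Km p x KmT pm (F_bdry _ _ KmT sm F2 _ xF).
  by have := phi01 Kk p x KkT pk (F_bdry _ _ KkT sk F2 _ xF); lra.
- apply: bigmax_seq_le => // K KT _; apply: bigmax_seq_le => // F.
  rewrite !inE fpowersetE => /andP[FK /eqP F2] _.
  apply: bigmax_seq_le => // p pF _.
  apply: (energy_le K) => // x xF; rewrite ler_norml.
  by have := phi01 K p x KT (fsubsetP FK _ pF) (F_bdry _ _ KT FK F2 _ xF); lra.
Qed.
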